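(* Let $n \ge 4$ be an integer with $n \ne 6$, and let $\rho$ be an integer with $1 \le \rho \le n-1$. Then there exists a $(3n-1+\rho,4)$-packing with exactly $(n-1)\rho + D(\rho,4)$ blocks in which the largest partial parallel class has size $\rho$.
   Context: For integers $v \ge k \ge 2$, a $(v,k)$-packing is a pair $(X,\mathcal{B})$ where $X$ is a set of $v$ points and $\mathcal{B}$ is a set of $k$-subsets of $X$ (blocks) such that every pair of distinct points lies in at most one block. For integers $m \ge 0$, $D(m,k)$ denotes the maximum number of $k$-subsets of an $m$-set such that every pair of points lies in at most one of them (so $D(m,k)=0$ if $m<k$). A partial parallel class (PPC) is a set of pairwise disjoint blocks; its size is the number of blocks. ''The largest PPC has size $\rho$'' means the packing has a PPC of size $\rho$ but none of size $\rho+1$. *)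

(* Defs.v *)
From mathcomp Require Import all_boot.
Set Implicit Arguments. Unset Strict Implicit. Unset Printing Implicit Defensive.

Definition is_packing (T : finType) (k : nat) (B : {set {set T}}) : bool :=
  [forall b in B, #|b| == k] &&
  [forall x : T, forall y : T,
     (x != y) ==> (#|[set b in B | (x \in b) && (y \in b)]| <= 1)].

Definition Dpack (m k : nat) : nat :=
  \max_(B : {set {set 'I_m}} | is_packing k B) #|B|.

Definition is_ppc (T : finType) (B P : {set {set T}}) : Prop :=
  P \subset B /\ (forall b c, b \in P -> c \in P -> b != c -> [disjoint b & c]).

Definition largest_ppc_size (T : finType) (B : {set {set T}}) (rho : nat) : Prop :=
  (exists P, is_ppc B P /\ #|P| = rho) /\
  ~ (exists P, is_ppc B P /\ #|P| = rho.+1).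

(* Main.v *)
Require Import Defs.
From mathcomp Require Import all_boot zify.

(* On 3n-1 points, take n-1 pairwise edge-disjoint classes of n-1 disjoint
   triples, together with one triple of each class so that these n-1 triples are
   pairwise disjoint. Join each of rho new points to the triples of its own
   class and put a maximum packing on the new points. Every block meets the new
   points, so no PPC exceeds rho, and the chosen triples give one of size rho.

   The classes are the N translates of one base parallel class on
   {0,1,2} x Z/N whose differences (pure and mixed) are all distinct; the
   translates of a base triple meeting the three orbits provide the disjoint
   triples. With N = n-1 these classes are used as they stand; with N = n one
   deletes a point of the chosen triple of one class and drops that class.
   Choosing N odd whenever n > 4, a base class is needed for N = 4 and for all
   odd N > 4. If N is coprime to 6, the triples (i, 2i, 3i) work. *)

(** * Packings built from classes of disjoint triples *)

Lemma is_packingP (T : finType) (k : nat) (B : {set {set T}}) :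
  reflect ((forall b, b \in B -> #|b| = k) /\
           (forall b c x y, b \in B -> c \in B -> x != y ->
              x \in b -> y \in b -> x \in c -> y \in c -> b = c))
          (is_packing k B).
Proof.
apply: (iffP andP) => -[Bk B1]; split.
- by move=> b bB; apply/eqP; exact: (implyP (forallP Bk b)).
- move=> b c x y bB cB xy xb yb xc yc.
  have /card_le1_eqP := implyP (forallP (forallP B1 x) y) xy.
  by apply; rewrite inE ?bB ?cB ?xb ?xc ?yb ?yc.
- by apply/forallP => b; apply/implyP => /Bk ->.
- apply/forallP => x; apply/forallP => y; apply/implyP => xy.
  apply/card_le1_eqP => b c; rewrite !inE.
  move=> /andP [bB /andP [xb yb]] /andP [cB /andP [xc yc]].
  exact: (B1 c b x y).
Qed.

(** [S] holds the old points in use, so that a deleted point may stay in the type [V]. Joined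
    triples with a common new point come from one class, where triples are disjoint; those from
    different classes share only old points, hence at most one. *)
Lemma packing_of_classes (V : finType) (S : {set V}) (m v rho : nat)
    (phi : V -> 'I_v) (K : 'I_rho -> {set {set V}}) (tau : 'I_rho -> {set V}) :
  {in S &, injective phi} ->
  (forall r, #|K r| = m) ->
  (forall r b, b \in K r -> #|b| = 3 /\ b \subset S) ->
  (forall r, trivIset (K r)) ->
  (forall r s b c, r != s -> b \in K r -> c \in K s -> #|b :&: c| <= 1) ->
  (forall r, tau r \in K r) ->
  (forall r s, r != s -> [disjoint tau r & tau s]) ->
  exists B : {set {set 'I_(v + rho)}},
    is_packing 4 B /\ #|B| = m * rho + Dpack rho 4 /\ largest_ppc_size B rho.
Proof.
move=> phiI cardK K3 Ktriv Kmeet tauK tauD.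
have [Bm BmP cardBm] : exists2 Bm : {set {set 'I_rho}}, is_packing 4 Bm & Dpack rho 4 = #|Bm|.
  have H : 0 < #|[pred B : {set {set 'I_rho}} | is_packing 4 B]|.
    apply/card_gt0P; exists set0; rewrite unfold_in /=.
    by apply/is_packingP; split=> [b|b c x y]; rewrite inE.
  by have [B BP Bmax] := eq_bigmax_cond (fun B : {set {set 'I_rho}} => #|B|) H; exists B.
pose h x : 'I_(v + rho) := lshift rho (phi x).
pose g r : 'I_(v + rho) := rshift v r.
have hI : {in S &, injective h} by move=> x y xS yS /lshift_inj; apply: phiI.
have gI : injective g by apply: rshift_inj.
have hgF x r : h x <> g r.
  by move/(congr1 (@nat_of_ord _)) => /=; have := ltn_ord (phi x); lia.
pose blk (p : 'I_rho * {set V}) := g p.1 |: h @: p.2.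
pose A := [set p : 'I_rho * {set V} | p.2 \in K p.1].
have gblk r p : (g r \in blk p) = (r == p.1).
  rewrite !inE (inj_eq gI); case: eqP => //= _.
  by apply/imsetP => -[x _ /esym /hgF].
have hblk x p : p \in A -> x \in S -> (h x \in blk p) = (x \in p.2).
  rewrite inE => /K3 [_ /subsetP sub] xS; rewrite !inE.
  have /negbTE-> : h x != g p.1 by apply/eqP => /hgF.
  by apply/imsetP/idP => [[y yp /hI ->] //|xp]; [apply: sub | exists x].
have blkP u p : p \in A -> u \in blk p ->
    u = g p.1 \/ exists x, [/\ x \in S, x \in p.2 & u = h x].
  rewrite inE => /K3 [_ /subsetP sub] /setU1P [->|/imsetP [x xp ->]]; first by left.
  by right; exists x; split=> //; apply: sub.
have Aeq x p q : p \in A -> q \in A -> p.1 = q.1 -> x \in p.2 -> x \in q.2 -> p = q.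
  case: p q => [r b] [s c] /=; rewrite !inE /= => bK cK rs xb xc; subst s.
  congr (_, _); apply/eqP; apply: contraTT xc => bc.
  have /trivIsetP/(_ b c bK cK bc) := Ktriv r.
  by rewrite disjoint_subset => /subsetP/(_ x xb); rewrite inE.
have A_nonempty p : p \in A -> exists2 x, x \in S & x \in p.2.
  rewrite inE => /K3 [p3 /subsetP sub].
  have /card_gt0P [x xp] : 0 < #|p.2| by rewrite p3.
  by exists x => //; apply: sub.
have blkI : {in A &, injective blk}.
  move=> p q pA qA pq.
  have p1q1 : p.1 = q.1 by apply/eqP; rewrite -gblk -pq gblk.
  have [x xS xp] := A_nonempty p pA.
  by apply: (Aeq x) => //; rewrite -hblk // -pq hblk.
have cardA : #|A| = m * rho.
  rewrite -sum1dep_card -(pair_big_dep predT (fun r b => b \in K r) (fun _ _ => 1)) /=.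
  under eq_bigr do rewrite sum1_card cardK.
  by rewrite sum_nat_const card_ord mulnC.
pose B1 := blk @: A; pose B2 := [set g @: b | b : {set 'I_rho} in Bm].
exists (B1 :|: B2).
have B12 : [disjoint B1 & B2].
  rewrite disjoint_subset; apply/subsetP => _ /imsetP [p pA ->].
  rewrite !inE; apply/imsetP => -[b _ E].
  have [x xS xp] := A_nonempty p pA.
  have : h x \in blk p by rewrite hblk.
  by rewrite E => /imsetP [r _ /hgF].
case/is_packingP: BmP => Bm4 BmM.
have Bg b : b \in B1 :|: B2 -> exists r, g r \in b.
  case/setUP => [/imsetP [p pA ->]|/imsetP [c cB ->]].
    by exists p.1; rewrite gblk.
  have /card_gt0P [r rc] : 0 < #|c| by rewrite Bm4.
  by exists r; apply: imset_f.
split; [|split; [|split]].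
- apply/is_packingP; split.
    move=> b /setUP [/imsetP [p pA ->]|/imsetP [c cB ->]]; last first.
      by rewrite card_imset // Bm4.
    have := pA; rewrite inE => /K3 [p3 /subsetP sub].
    rewrite cardsU1 card_in_imset ?p3; last by move=> x y /sub xS /sub yS; apply: hI.
    by case: imsetP => // -[x _ /esym /hgF].
  (* A joined triple has a single new point, while the blocks of [B2] consist of new points. *)
  have mixed b c u w : u != w -> b \in B1 -> c \in B2 ->
      u \in b -> w \in b -> u \in c -> w \in c -> False.
    move=> uw /imsetP [p pA ->] /imsetP [d _ ->] + + /imsetP [r _ ur] /imsetP [s _ ws].
    rewrite ur ws !gblk => /eqP rp /eqP sp.
    by move: uw; rewrite ur ws rp sp eqxx.
  (* If [u] is new, both triples lie in its class and meet in [x]; if [u] is old, triples of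
     different classes cannot share both points. *)
  have pure p q u x : p \in A -> q \in A -> u != h x -> x \in S ->
      u \in blk p -> h x \in blk p -> u \in blk q -> h x \in blk q -> p = q.
    move=> pA qA ux xS up xp uq xq.
    rewrite hblk // in xp; rewrite hblk // in xq.
    case: (blkP _ _ pA up) => [ug|[y [yS yp uy]]].
      by apply: (Aeq x) => //; apply/eqP; rewrite -gblk -ug.
    rewrite uy hblk // in uq.
    have [pq|pq] := eqVneq p.1 q.1; first exact: (Aeq x).
    rewrite !inE in pA qA.
    have /card_le1_eqP/(_ y x) := Kmeet _ _ _ _ pq pA qA.
    rewrite !inE yp xp xq uq => /(_ isT isT) yx.
    by rewrite uy yx eqxx in ux.
  move=> b c u w bB cB uw ub wb uc wc.
  case/setUP: bB => bB; case/setUP: cB => cB.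
  + case/imsetP: bB ub wb => p pA -> up wp; case/imsetP: cB uc wc => q qA -> uq wq.
    congr blk.
    case: (blkP _ _ pA wp) => [wg|[x [xS xp wx]]].
      case: (blkP _ _ pA up) => [ug|[x [xS xp ux]]]; first by rewrite wg ug eqxx in uw.
      by apply: (pure p q w x); rewrite -?ux // eq_sym.
    by apply: (pure p q u x); rewrite -?wx.
  + by case: (mixed b c u w).
  + by case: (mixed c b u w).
    case/imsetP: bB ub wb uc wc => d dB -> /imsetP [r rd ur] /imsetP [s sd ws].
    rewrite {}ur {}ws in uw *; case/imsetP: cB => e eB ->.
    rewrite !(mem_imset _ _ gI) => re se; rewrite (inj_eq gI) in uw.
    by rewrite (BmM d e r s).
- rewrite cardsU disjoint_setI0 // cards0 subn0 cardBm.
  rewrite card_in_imset // cardA card_imset //.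
  exact: imset_inj.
- exists [set blk (r, tau r) | r : 'I_rho]; split; last first.
    rewrite card_imset ?card_ord // => r s.
    by move=> /blkI; rewrite !inE /= => /(_ (tauK r) (tauK s)) [].
  split.
    apply/subsetP => _ /imsetP [r _ ->]; rewrite inE imset_f //.
    by rewrite inE /=.
  move=> _ _ /imsetP [r _ ->] /imsetP [s _ ->] rs.
  have rs' : r != s by apply: contraNneq rs => ->.
  rewrite disjoint_subset; apply/subsetP => u.
  have rA : (r, tau r) \in A by rewrite inE /=.
  have sA : (s, tau s) \in A by rewrite inE /=.
  case/(blkP _ _ rA) => [->|[x [xS xr ->]]]; rewrite inE /=.
    by rewrite gblk.
  rewrite hblk //=; have := tauD r s rs'.
  by rewrite disjoint_subset => /subsetP/(_ x xr).
- case=> P [[/subsetP PB Pdisj] cardP].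
  have [P0|/set0Pn [b0 b0P]] := eqVneq P set0.
    by rewrite P0 cards0 in cardP.
  have [r0 _] := Bg b0 (PB b0 b0P).
  (* [f] picks a new point of each block, with [r0] as default value. Disjoint blocks get distinct
     new points, so a PPC injects into ['I_rho]. *)
  pose f (b : {set 'I_(v + rho)}) := odflt r0 [pick r | g r \in b].
  have fP b : b \in P -> g (f b) \in b.
    move=> /PB /Bg [r rb]; rewrite /f; case: pickP => [//|/(_ r)].
    by rewrite rb.
  have fI : {in P &, injective f}.
    move=> b c bP cP fbc; apply/eqP; apply: contraT => bc.
    have := Pdisj b c bP cP bc; rewrite disjoint_subset => /subsetP/(_ _ (fP b bP)).
    by rewrite inE fbc fP.
  have := max_card (f @: P); rewrite card_in_imset // card_ord cardP.
  by rewrite ltnn.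
Qed.

Lemma embedding_into_ord (V : finType) (S : {set V}) (v : nat) :
  #|S| <= v.+1 -> exists phi : V -> 'I_v.+1, {in S &, injective phi}.
Proof.
move=> Sv; exists (fun x => inord (index x (enum S))) => x y xS yS.
have lt z : z \in S -> index z (enum S) < v.+1.
  move=> zS; apply: leq_trans Sv.
  by rewrite cardE index_mem mem_enum.
move=> /(congr1 (@nat_of_ord _)); rewrite !inordK ?lt // => E.
by rewrite -(nth_index x (s := enum S) (x := x)) ?mem_enum // E nth_index ?mem_enum.
Qed.

(** Covering is a consequence: [N] disjoint triples exhaust [V] once [#|V| = 3 * N]. The triples
    [tau c] supply the PPC. *)
Definition parallel_classes (V : finType) (N : nat)
    (K : nat -> {set {set V}}) (tau : nat -> {set V}) : Prop :=
  [/\ forall c, c < N -> #|K c| = N /\ trivIset (K c),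
      forall c b, c < N -> b \in K c -> #|b| = 3,
      forall c d a b, c < N -> d < N -> c != d -> a \in K c -> b \in K d ->
        #|a :&: b| <= 1,
      forall c, c < N -> tau c \in K c
    & forall c d, c < N -> d < N -> c != d -> [disjoint tau c & tau d]].

(** Meant for [N = n - 1]: two of the [3n - 1] old points then lie in no block. *)
Lemma packing_of_parallel_classes (V : finType) (N v rho : nat) K tau :
  #|V| <= v.+1 -> rho <= N -> @parallel_classes V N K tau ->
  exists B : {set {set 'I_(v.+1 + rho)}},
    is_packing 4 B /\ #|B| = N * rho + Dpack rho 4 /\ largest_ppc_size B rho.
Proof.
move=> Vv rhoN [KN K3 Kmeet tauK tauD].
have [phi phiI] : exists phi : V -> 'I_v.+1, {in setT &, injective phi}.
  by apply: embedding_into_ord; rewrite cardsT.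
have ltN (r : 'I_rho) : r < N by apply: leq_trans rhoN.
apply: (@packing_of_classes V setT N v.+1 rho phi (fun r => K r) (fun r => tau r)) => //.
- by move=> r; case: (KN r).
- by move=> r b /K3 ->.
- by move=> r; case: (KN r).
- by move=> r s b c rs; apply: Kmeet.
- by move=> r; apply: tauK.
- by move=> r s rs; apply: tauD.
Qed.

(** Meant for [N = n]. Class 0 is dropped and a point [p0] of [tau 0] deleted, which costs every
    other class exactly one triple; [tau r.+1] survives because it is disjoint from [tau 0]. *)
Lemma packing_of_punctured_classes (V : finType) (N v rho : nat) K tau :
  #|V| = 3 * N -> 3 * N <= v.+2 -> rho < N -> @parallel_classes V N K tau ->
  exists B : {set {set 'I_(v.+1 + rho)}},
    is_packing 4 B /\ #|B| = N.-1 * rho + Dpack rho 4 /\ largest_ppc_size B rho.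
Proof.
move=> cardV Vv rhoN [KN K3 Kmeet tauK tauD].
have N0 : 0 < N by lia.
have /card_gt0P [p0 p0tau] : 0 < #|tau 0| by rewrite (K3 0) // tauK.
have [phi phiI] : exists phi : V -> 'I_v.+1, {in [set~ p0] &, injective phi}.
  by apply: embedding_into_ord; rewrite cardsC1 cardV; lia.
have ltN (r : 'I_rho) : r.+1 < N by have := ltn_ord r; lia.
pose K' (r : 'I_rho) := [set b in K r.+1 | p0 \notin b].
apply: (@packing_of_classes V [set~ p0] N.-1 v.+1 rho phi K' (fun r => tau r.+1)) => //.
- move=> r; have [cardK Ktriv] := KN _ (ltN r).
  (* By counting, [N] disjoint triples cover all [3 * N] points, so exactly one triple [b] of the
     class contains [p0]. *)
  have /setP/(_ p0) : cover (K r.+1) = setT.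
    apply/eqP; rewrite eqEcard subsetT cardsT cardV /=.
    rewrite -(eqP Ktriv) (eq_bigr (fun _ => 3)).
      by rewrite sum_nat_const cardK mulnC.
    by move=> b /K3 ->.
  rewrite inE => /bigcupP [b bK p0b].
  rewrite -cardK [in RHS](cardsD1 b) bK add1n /=; apply: eq_card => a; rewrite !inE.
  have [->|ab] := eqVneq a b; first by rewrite p0b andbF.
  case aK: (a \in K r.+1) => //=; apply/negP => p0a.
  have /trivIsetP/(_ a b aK bK ab) := Ktriv.
  by rewrite disjoint_subset => /subsetP/(_ p0 p0a); rewrite inE p0b.
- move=> r b; rewrite inE => /andP [/K3 -> // p0b]; split=> //.
  by apply/subsetP => x xb; rewrite !inE; apply: contraNneq p0b => <-.
- move=> r; apply: trivIsetS (proj2 (KN _ (ltN r))).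
  by apply/subsetP => b; rewrite inE => /andP [].
- move=> r s b c rs; rewrite !inE => /andP [bK _] /andP [cK _].
  by apply: (Kmeet _ _ _ _ (ltN r) (ltN s)); rewrite ?eqSS.
- move=> r; rewrite inE tauK //=.
  have := tauD 0 r.+1 N0 (ltN r) isT.
  by rewrite disjoint_subset => /subsetP/(_ p0 p0tau).
- by move=> r s rs; apply: tauD; rewrite ?eqSS.
Qed.

(** * Base classes and their translates *)

(* [orb t k] and [res t k] are the orbit and the residue of the [k]-th point of
   the [t]-th triple, in [{0,1,2} x Z/N]. *)
Definition base_class (N : nat) (orb res : nat -> nat -> nat) : Prop :=
  [/\ forall t k, t < N -> k < 3 -> orb t k < 3 /\ res t k < N,
      forall t u k l, t < N -> u < N -> k < 3 -> l < 3 ->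
        orb t k = orb u l -> res t k = res u l -> t = u /\ k = l,
      forall t u k l k' l', t < N -> u < N ->
        k < 3 -> l < 3 -> k' < 3 -> l' < 3 -> k != l -> k' != l' ->
        orb t k = orb u k' -> orb t l = orb u l' ->
        res t k + res u l' = res t l + res u k' %[mod N] -> t = u /\ k = k'
    & exists2 t, t < N & forall k l, k < 3 -> l < 3 -> orb t k = orb t l -> k = l].

(** Class [c] is the base class translated by [c]. Two points common to a triple of class [c] and
    one of class [d] come from pairs with the same orbits and the same residue difference, hence
    from one pair of one base triple, and then [c = d]. *)
Lemma parallel_classes_of_base_class (N : nat) orb res :
  base_class N.+1 orb res ->
  exists K tau, @parallel_classes ('I_3 * 'I_N.+1)%type N.+1 K tau.
Proof.
move=> [bounds pinj diff [t0 t0N t0orb]].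
pose pt c t k : 'I_3 * 'I_N.+1 :=
  (inord (orb t k), inord ((res t k + c) %% N.+1)).
have ptE c d t u k l : t < N.+1 -> u < N.+1 -> k < 3 -> l < 3 ->
    pt c t k = pt d u l -> orb t k = orb u l /\ res t k + c = res u l + d %[mod N.+1].
  move=> tN uN k3 l3 [/(congr1 (@nat_of_ord _)) + /(congr1 (@nat_of_ord _))].
  by rewrite !inordK ?ltn_pmod //; [case: (bounds u l)|case: (bounds t k)].
have ptI c t u k l : t < N.+1 -> u < N.+1 -> k < 3 -> l < 3 ->
    pt c t k = pt c u l -> t = u /\ k = l.
  move=> tN uN k3 l3 /ptE [] // eorb /eqP; rewrite eqn_modDr => /eqP.
  have [_ tr] := bounds t k tN k3; have [_ ur] := bounds u l uN l3.
  by rewrite !modn_small // => eres; apply: pinj.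
pose blk c t := [set pt c t (nat_of_ord k) | k : 'I_3].
have blkP c t p : reflect (exists2 k, k < 3 & p = pt c t k) (p \in blk c t).
  apply: (iffP imsetP) => [[k _ ->]|[k k3 ->]]; first by exists k.
  by exists (Ordinal k3).
have blk_eq c t u p : t < N.+1 -> u < N.+1 -> p \in blk c t -> p \in blk c u -> t = u.
  by move=> tN uN /blkP [k k3 ->] /blkP [l l3] /ptI [].
have blk0 c t : pt c t 0 \in blk c t by apply/blkP; exists 0.
pose K c := [set blk c (nat_of_ord t) | t : 'I_N.+1].
have KP c b : reflect (exists2 t, t < N.+1 & b = blk c t) (b \in K c).
  apply: (iffP imsetP) => [[t _ ->]|[t tN ->]]; first by exists t.
  by exists (Ordinal tN).
exists K, (fun c => blk c t0); split.
- move=> c cN; split.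
    rewrite card_imset ?card_ord // => t u E; apply: val_inj => /=.
    by apply: (blk_eq c _ _ (pt c t 0)); rewrite -?E.
  apply/trivIsetP => _ _ /KP [t tN ->] /KP [u uN ->] tu.
  rewrite disjoint_subset; apply/subsetP => p pt_; rewrite inE.
  by apply: contraNN tu => pu; rewrite (blk_eq c t u p).
- move=> c _ cN /KP [t tN ->]; rewrite card_imset ?card_ord // => k l E.
  by apply: val_inj; case: (ptI c t t k l).
- move=> c d _ _ cN dN cd /KP [t tN ->] /KP [u uN ->].
  apply/card_le1_eqP => p q; rewrite !inE => /andP [pt_ pu] /andP [qt qu].
  apply/eqP; apply: contraNT cd => pq.
  case/blkP: pt_ => k k3 pE; case/blkP: qt => l l3 qE.
  case/blkP: pu => k' k3' /esym; rewrite {1}pE => /esym /ptE [] // ek rk.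
  case/blkP: qu => l' l3' /esym; rewrite {1}qE => /esym /ptE [] // el rl.
  have kl : k != l by apply: contraNneq pq => E; rewrite pE qE E.
  have kl' : k' != l'.
    apply: contraNneq kl => E; rewrite -{}E in el rl.
    have /eqP : res t k + c = res t l + c %[mod N.+1] by rewrite rk rl.
    rewrite eqn_modDr => /eqP; rewrite !modn_small; last 2 first.
    - by case: (bounds t l).
    - by case: (bounds t k).
    move=> er; apply/eqP; case: (pinj t t k l) => //; congruence.
  (* Equal differences are written with sums, since subtraction on [nat] truncates; adding [c + d]
     lets the translated residues be regrouped. *)
  have /eqP Ediff : res t k + res u l' + (c + d) = res t l + res u k' + (c + d) %[mod N.+1].
    rewrite (_ : _ + _ + (c + d) = (res t k + c) + (res u l' + d)); last by lia.
    rewrite [in RHS](_ : _ + _ + (c + d) = (res t l + c) + (res u k' + d)); last by lia.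
    by rewrite -modnDm rk -rl modnDm addnC.
  rewrite eqn_modDr in Ediff.
  have [tu kk] := diff _ _ _ _ _ _ tN uN k3 l3 k3' l3' kl kl' ek el (eqP Ediff).
  rewrite tu kk in rk.
  by move/eqP: rk; rewrite eqn_modDl !modn_small.
- by move=> c cN; apply/KP; exists t0.
(* The triple [t0] meets each orbit once, so a point common to two of its translates has the same
   index in both, which forces [c = d]. *)
- move=> c d cN dN cd; rewrite disjoint_subset; apply/subsetP => p.
  case/blkP => k k3 ->; rewrite inE; apply: contraNN cd => /blkP [l l3 /ptE].
  case=> // ek; rewrite (t0orb k l) // => /eqP.
  by rewrite eqn_modDl !modn_small.
Qed.

(** * Base classes for [N] coprime to 6 *)

Lemma eqn_mod_cancel (N d t u : nat) :
  coprime N d -> t < N -> u < N -> d * t = d * u %[mod N] -> t = u.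
Proof.
move=> coNd; wlog tu : t u / t <= u.
  move=> H tN uN E; case: (leqP t u) => [/H -> //|/ltnW /H E'].
  by rewrite E'.
move=> _ uN /esym /eqP; rewrite eqn_mod_dvd ?leq_mul2l ?tu ?orbT //.
rewrite -mulnBr Gauss_dvdr // => /dvdn_leq; case: posnP => [|_ /(_ isT)]; lia.
Qed.

(** Every triple meets all three orbits, so only mixed differences occur, and between orbits [k < l]
    triple [t] has [(l - k) * t]. The factors 1, 2, 3 of the points and 1, 2 of the differences are
    units mod [N], so each value determines [t]. *)
Lemma base_class_coprime6 (N : nat) :
  0 < N -> coprime N 6 -> base_class N (fun _ k => k) (fun t k => (k.+1 * t) %% N).
Proof.
move=> N0; rewrite (coprimeMr N 2 3) => /andP [co2 co3].
have co k : k < 3 -> coprime N k.+1 by case: k => [|[|[|]]]; rewrite ?coprimen1.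
split=> [t k tN k3|t u k l tN uN k3 _ <-|t u k l k' l' tN uN k3 l3 _ _ kl _ <- <-|].
- by rewrite ltn_pmod.
- by move=> E; split=> //; apply: eqn_mod_cancel E => //; apply: co.
- rewrite !modnDm => E; split=> //; move: E.
  case: (ltngtP k l) kl => // kl _.
  + rewrite (_ : k.+1 * t + l.+1 * u = (k.+1 * t + k.+1 * u) + (l - k) * u); last by nia.
    rewrite (_ : l.+1 * t + k.+1 * u = (k.+1 * t + k.+1 * u) + (l - k) * t); last by nia.
    move/eqP; rewrite eqn_modDl => /eqP /esym; apply: eqn_mod_cancel => //.
    by rewrite (_ : l - k = (l - k).-1.+1); [apply: co|]; lia.
  + rewrite (_ : k.+1 * t + l.+1 * u = (l.+1 * t + l.+1 * u) + (k - l) * t); last by nia.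
    rewrite (_ : l.+1 * t + k.+1 * u = (l.+1 * t + l.+1 * u) + (k - l) * u); last by nia.
    move/eqP; rewrite eqn_modDl => /eqP; apply: eqn_mod_cancel => //.
    by rewrite (_ : k - l = (k - l).-1.+1); [apply: co|]; lia.
- by exists 0.
Qed.

(** * Base classes for [N] divisible by 3 *)

(* Triples are rotated through the three orbits: triple 0 has its points in
   orbits j, j+1, j+2, every other triple in orbits j, j, j+1. *)
Definition slot_offset (s k : nat) : nat := if s == 0 then k else (k == 2).

(** Index [t] stands for the triple [t %/ 3] rotated by [t %% 3]. Rotation keeps orbit differences,
    so only pairs whose offsets differ equally mod 3 have to be compared. A residue determines its
    triple and slot, after which the orbit determines the rotation. *)
Lemma base_class_rotation (M : nat) (q : nat -> nat -> nat) :
  0 < M ->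
  (forall s k, s < M -> k < 3 -> q s k < 3 * M) ->
  (forall s u k l, s < M -> u < M -> k < 3 -> l < 3 -> q s k = q u l -> s = u /\ k = l) ->
  (forall s u k l k' l', s < M -> u < M ->
     k < 3 -> l < 3 -> k' < 3 -> l' < 3 -> k != l -> k' != l' ->
     slot_offset s k + slot_offset u l' = slot_offset s l + slot_offset u k' %[mod 3] ->
     q s k + q u l' = q s l + q u k' %[mod 3 * M] -> s = u /\ k = k') ->
  base_class (3 * M) (fun t k => (t %% 3 + slot_offset (t %/ 3) k) %% 3)
    (fun t k => q (t %/ 3) k).
Proof.
move=> M0 bound inj diff.
have divM t : t < 3 * M -> t %/ 3 < M by lia.
have ext t u : t %/ 3 = u %/ 3 -> t %% 3 = u %% 3 -> t = u by lia.
have cancel t u a : (t %% 3 + a) %% 3 = (u %% 3 + a) %% 3 -> t %% 3 = u %% 3.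
  by move/eqP; rewrite eqn_modDr !modn_mod => /eqP.
split=> [t k tM k3|t u k l tM uM k3 l3 eo er|t u k l k' l' tM uM k3 l3 k3' l3' kl kl' eo eo' er|].
- by rewrite ltn_pmod ?bound ?divM.
- have [tu kl] := inj _ _ _ _ (divM _ tM) (divM _ uM) k3 l3 er; split=> //.
  by apply: ext => //; apply: (cancel _ _ (slot_offset (t %/ 3) k)); rewrite eo tu kl.
- have [] := diff _ _ _ _ _ _ (divM _ tM) (divM _ uM) k3 l3 k3' l3' kl kl' _ er.
    by lia.
  move=> tu kk; split=> //; apply: ext => //.
  by apply: (cancel _ _ (slot_offset (t %/ 3) k)); rewrite eo tu kk.
- by exists 0 => [|k l k3 l3]; [lia | rewrite div0n mod0n /slot_offset /= !modn_small].
Qed.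

(* For N = 6k+3. The two linear families have pure differences = 2 and = 1 mod 3
   up to sign, and their mixed differences fill two intervals plus the odd and
   the even residues of two further intervals. Triple k+1, with
   y = 6k+1 in place of the value 6k given by the last family, and triple 0
   absorb the leftover points. Distinctness fails for k <= 1. *)
Definition rotation_triples (k s c : nat) : nat :=
  if s == 0 then nth 0 [:: 4 * k; 6 * k; 6 * k + 2] c
  else if s <= k then nth 0 [:: 2 * s - 2; 3 * k - s; 3 * k + s - 1] c
  else if s == k.+1 then nth 0 [:: 1; 6 * k + 1; 4 * k + 1] c
  else nth 0 [:: 2 * (s - k) - 1; 7 * k + 1 - s; 3 * k + s] c.

(** Sums of two residues lie below [2 * N], so this turns their congruences into linear equations
    that [lia] can use. *)
Lemma eqn_mod_double (N a b : nat) : a < 2 * N -> b < 2 * N -> a = b %[mod N] ->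
  a = b \/ a = b + N \/ b = a + N.
Proof.
move=> aN bN E; have [ab|ab] := leqP a b.
  by move/esym/eqP: E; rewrite eqn_mod_dvd // => /dvdnP [[|[|q]] E]; nia.
by move/eqP: E; rewrite eqn_mod_dvd 1?ltnW // => /dvdnP [[|[|q]] E]; nia.
Qed.

Lemma rotation_triplesP (k s : nat) (q := rotation_triples k) : s < (2 * k).+1 ->
  [\/ s = 0 /\ [/\ q s 0 = 4 * k, q s 1 = 6 * k & q s 2 = 6 * k + 2],
      0 < s <= k /\ [/\ q s 0 = 2 * s - 2, q s 1 = 3 * k - s & q s 2 = 3 * k + s - 1],
      s = k.+1 /\ [/\ q s 0 = 1, q s 1 = 6 * k + 1 & q s 2 = 4 * k + 1]
    | k.+1 < s <= 2 * k /\
      [/\ q s 0 = 2 * (s - k) - 1, q s 1 = 7 * k + 1 - s & q s 2 = 3 * k + s]].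
Proof.
move=> sk; rewrite /q /rotation_triples.
have [->|s0] := eqVneq s 0; first by apply: Or41.
have [sk'|sk'] := leqP s k; first by apply: Or42; rewrite lt0n s0.
have [->|sk1] := eqVneq s k.+1; first by apply: Or43.
by apply: Or44; split=> //; lia.
Qed.

Lemma ord3_cases (k : nat) : k < 3 -> [\/ k = 0, k = 1 | k = 2].
Proof. by case: k => [|[|[|]]] // _; [apply: Or31 | apply: Or32 | apply: Or33]. Qed.

Lemma base_class_6k3 (k : nat) : 1 < k ->
  base_class (3 * (2 * k).+1)
    (fun t c => (t %% 3 + slot_offset (t %/ 3) c) %% 3)
    (fun t c => rotation_triples k (t %/ 3) c).
Proof.
move=> k1.
have bound s c : s < (2 * k).+1 -> c < 3 -> rotation_triples k s c < 3 * (2 * k).+1.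
  move=> /rotation_triplesP H /ord3_cases [] ->;
  by case: H => -[hs [s0 s1 s2]]; rewrite (s0, s1, s2); lia.
apply: base_class_rotation => //.
- move=> s u c d sM uM /ord3_cases [] -> /ord3_cases [] ->;
  case: (rotation_triplesP _ _ sM) => -[hs [s0 s1 s2]];
  case: (rotation_triplesP _ _ uM) => -[hu [u0 u1 u2]];
  rewrite ?(s0, s1, s2) ?(u0, u1, u2); lia.
- move=> s u c d c' d' sM uM c3 d3 c3' d3' cd cd' eo er.
  have er' := eqn_mod_double _ _ _ _ _ er.
  have := (bound s c sM c3, bound s d sM d3, bound u c' uM c3', bound u d' uM d3').
  move=> [[[b1 b2] b3] b4]; move: er' => /(_ ltac:(lia) ltac:(lia)).
  move: c3 d3 c3' d3' cd cd' eo {er b1 b2 b3 b4}.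
  have o0 t : t = 0 -> slot_offset t =1 fun k => k by move=> ->.
  have o1 t : 0 < t -> slot_offset t =1 fun k => k == 2 by case: t.
  case: (rotation_triplesP _ _ sM) => -[hs [s0 s1 s2]];
  case: (rotation_triplesP _ _ uM) => -[hu [u0 u1 u2]];
  first [have {}os := o0 s hs | have {}os := o1 s ltac:(lia)];
  first [have {}ou := o0 u hu | have {}ou := o1 u ltac:(lia)];
  clear o0 o1 bound;
  (* Pairs of slots with different orbit differences are refuted by computation; the rest is linear
     arithmetic in each of the sixteen combinations of families. *)
  move=> /ord3_cases [] -> /ord3_cases [] -> // /ord3_cases [] -> /ord3_cases [] -> // _ _;
  rewrite !os !ou => /eqP // _;
  rewrite ?(s0, s1, s2) ?(u0, u1, u2); clear -k1 hs hu; lia.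
Qed.

(** * Small base classes by computation *)

Lemma all_iotaP (n : nat) (a : pred nat) :
  reflect (forall i, i < n -> a i) (all a (iota 0 n)).
Proof.
by apply: (iffP allP) => H i; have := H i; rewrite mem_iota.
Qed.

Definition check_base_class (N : nat) (orb res : nat -> nat -> nat) : bool :=
  let r := iota 0 N in let i3 := iota 0 3 in
  [&& all (fun t => all (fun k => (orb t k < 3) && (res t k < N)) i3) r,
      all (fun t => all (fun u => all (fun k => all (fun l =>
        [&& orb t k == orb u l & res t k == res u l] ==> (t == u) && (k == l))
        i3) i3) r) r,
      all (fun t => all (fun u => all (fun k => all (fun l => all (fun k' => all (fun l' =>
        [&& k != l, k' != l', orb t k == orb u k', orb t l == orb u l'
          & res t k + res u l' == res t l + res u k' %[mod N]] ==> (t == u) && (k == k'))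
        i3) i3) i3) i3) r) r
    & has (fun t => all (fun k => all (fun l => (orb t k == orb t l) ==> (k == l)) i3) i3) r].

Lemma check_base_classP (N : nat) orb res :
  check_base_class N orb res -> base_class N orb res.
Proof.
case/and4P => /all_iotaP bnd /all_iotaP inj /all_iotaP diff /hasP [t0].
rewrite mem_iota => t0N /all_iotaP t0P.
split=> [t k tN k3|t u k l tN uN k3 l3 eo er|t u k l k' l' tN uN k3 l3 k3' l3' kl kl' eo eo' er|].
- by have /all_iotaP/(_ k k3)/andP := bnd t tN.
- have /all_iotaP/(_ u uN)/all_iotaP/(_ k k3)/all_iotaP/(_ l l3) := inj t tN.
  by rewrite eo er !eqxx => /andP [/eqP-> /eqP->].
- have /all_iotaP/(_ u uN)/all_iotaP/(_ k k3)/all_iotaP/(_ l l3) := diff t tN.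
  move=> /all_iotaP/(_ k' k3')/all_iotaP/(_ l' l3').
  by rewrite kl kl' eo eo' er !eqxx => /andP [/eqP-> /eqP->].
- exists t0 => // k l k3 l3 eo.
  have /all_iotaP/(_ l l3) := t0P k k3.
  by rewrite eo eqxx => /eqP.
Qed.

(** The case [k = 1] of [N = 6k + 3], with other triples in the same rotation scheme; together they
    use each residue mod 9 once. *)
Lemma base_class_9 : exists orb res, base_class 9 orb res.
Proof.
pose q := [:: [:: 0; 1; 6]; [:: 2; 4; 8]; [:: 3; 7; 5]].
exists (fun t k => (t %% 3 + slot_offset (t %/ 3) k) %% 3).
exists (fun t k => nth 0 (nth [::] q (t %/ 3)) k).
by apply: check_base_classP; vm_compute.
Qed.

(** Triple 0, with points [(0,0)], [(1,0)], [(2,0)], is fixed by rotating the orbits; the other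
    three are the rotations of [(0,1)], [(0,2)], [(1,3)]. *)
Lemma base_class_4 : exists orb res, base_class 4 orb res.
Proof.
exists (fun t k => nth 0 (nth [::] [:: [:: 0; 1; 2]; [:: 0; 0; 1]; [:: 1; 1; 2]; [:: 2; 2; 0]] t) k).
exists (fun t k => if t == 0 then 0 else k.+1).
by apply: check_base_classP; vm_compute.
Qed.

(** * Odd [N > 4], and the choice of [N] for a given [n] *)

Lemma base_class_odd (N : nat) : odd N -> 4 < N -> exists orb res, base_class N orb res.
Proof.
move=> oddN N4; have [N3|N3] := boolP (3 %| N).
  have [k NE] : exists k, N = 3 * (2 * k).+1.
    case/dvdnP: N3 => m E; exists m./2.
    move: oddN; rewrite E oddM andbT => oddm.
    by rewrite mul2n -[in LHS](odd_double_half m) oddm mulnC.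
  rewrite {}NE in N4 *.
  have [k1|k1] := ltnP 1 k.
    by do 2 eexists; apply: base_class_6k3.
  (* [k = 0] would be [N = 3], which [4 < N] excludes. *)
  have [->|k0] : k = 1 \/ k = 0 by lia.
    exact: base_class_9.
  by move: N4; rewrite k0.
do 2 eexists; apply: base_class_coprime6; first by lia.
rewrite (coprimeMr N 2 3) coprimen2 oddN /= coprime_sym prime_coprime //.
Qed.

Theorem theorem2p8 (n rho : nat) :
  4 <= n -> n != 6 -> 1 <= rho <= n - 1 ->
  exists B : {set {set 'I_(3 * n - 1 + rho)}},
    is_packing 4 B /\
    #|B| = (n - 1) * rho + Dpack rho 4 /\
    largest_ppc_size B rho.
Proof.
move=> n4 _ /andP [_ rhon].
have -> : 3 * n - 1 = (3 * n - 2).+1 by lia.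
have punctured : (exists orb res, base_class n orb res) ->
    exists B : {set {set 'I_((3 * n - 2).+1 + rho)}},
      is_packing 4 B /\ #|B| = (n - 1) * rho + Dpack rho 4 /\ largest_ppc_size B rho.
  case: n n4 rhon => // n n4 rhon [orb [res /parallel_classes_of_base_class [K [tau P]]]].
  rewrite subn1; apply: packing_of_punctured_classes P; last by lia.
    by rewrite card_prod !card_ord.
  by lia.
(* Odd [n] takes [N = n]; even [n] takes the odd number [N = n - 1], except that [n = 4] would give
   3, outside [base_class_odd], and takes [N = 4] instead. *)
have [oddn|evenn] := boolP (odd n).
  apply: punctured; apply: base_class_odd => //.
  by rewrite ltn_neqAle n4 andbT; apply: contraTneq oddn => <-.
have [n4E|n4F] := eqVneq n 4.
  by apply: punctured; rewrite n4E; apply: base_class_4.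
case: n n4 rhon evenn n4F {punctured} => [|[|n]] // n4 rhon evenn n4F.
have [|| orb [res]] := @base_class_odd n.+1.
- by move: evenn => /=; rewrite negbK.
- by lia.
move=> /parallel_classes_of_base_class [K [tau P]].
rewrite subn1; apply: packing_of_parallel_classes P; last by lia.
by rewrite card_prod !card_ord; lia.
Qed.
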